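(* Let $M_1$ be a timelike helicoidal surface of type I in $\mathbb{E}^n_1$ ($n\ge 3$), parametrized by $H_1(u,v)=(x_1(u)\cos v, x_1(u)\sin v, x_3(u),\dots,x_{n-1}(u),x_n(u)+cv)$ with $c>0$, let $\phi_0\ge 0$ be a constant, and let $\alpha_1(t)=H_1(u(t),v(t))$ be a smooth curve on $M_1$ with $\dot u(t)\neq 0$ for all $t$. Then $\alpha_1$ is a timelike loxodrome with constant angle $\phi_0$ if and only if the following differential equation is satisfied for all $t$ (with $u=u(t)$, $v=v(t)$ and dots denoting derivatives with respect to $t$): (i) if the meridians of $M_1$ are spacelike ($\varepsilon=1$), $$(\sinh^2\phi_0\,(x_1^2(u)-c^2)+c^2x_n'^2(u))\,\dot v^2-2c\cosh^2\phi_0\,x_n'(u)\,\dot u\dot v+\cosh^2\phi_0\,\dot u^2=0;$$ (ii) if the meridians of $M_1$ are timelike ($\varepsilon=-1$), $$(\cosh^2\phi_0\,(x_1^2(u)-c^2)+c^2x_n'^2(u))\,\dot v^2-2c\sinh^2\phi_0\,x_n'(u)\,\dot u\dot v-\sinh^2\phi_0\,\dot u^2=0.$$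
   Context: $\mathbb{E}^n_1$ is $\mathbb{R}^n$ with the metric $\langle\cdot,\cdot\rangle$ given by $dx_1^2+\cdots+dx_{n-1}^2-dx_n^2$, and $\|w\|=\sqrt{|\langle w,w\rangle|}$. A vector $w$ is spacelike if $\langle w,w\rangle>0$ or $w=0$, timelike if $\langle w,w\rangle<0$; a curve is timelike if its velocity is timelike everywhere. Helicoidal surface of type I: let $I\subset\mathbb{R}$ be an open interval, $\beta(u)=(x_1(u),0,x_3(u),\dots,x_n(u))$, $u\in I$, a smooth regular curve parametrized by arc length, i.e. $x_1'^2+x_3'^2+\cdots+x_{n-1}'^2-x_n'^2=\varepsilon$ with $\varepsilon\in\{1,-1\}$ constant, and $c>0$ a constant. The surface is parametrized by $H_1$ ($u\in I$, $v$ an angular parameter; the formula for $H_1$ is used for all real $v$). It is timelike if $EG-F^2<0$ everywhere, where $E=\langle (H_1)_u,(H_1)_u\rangle$, $F=\langle (H_1)_u,(H_1)_v\rangle$, $G=\langle (H_1)_v,(H_1)_v\rangle$; equivalently $\varepsilon x_1^2(u)-c^2(\varepsilon+x_n'^2(u))<0$ for all $u$. The meridians are the curves $u\mapsto H_1(u,v_0)$ with $v_0$ constant; they are spacelike if $\varepsilon=1$ and timelike if $\varepsilon=-1$. Lorentzian angle: for $x$ nonzero spacelike and $y$ timelike, the angle is the unique $\theta\ge0$ with $\langle x,y\rangle=\pm\|x\|\|y\|\sinh\theta$; for $x,y$ both timelike, it is the unique $\theta\ge 0$ with $\langle x,y\rangle=\pm\|x\|\|y\|\cosh\theta$. A timelike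 loxodrome with constant angle $\phi_0\ge0$ is a timelike curve $\alpha_1(t)=H_1(u(t),v(t))$ such that, for every $t$, the Lorentzian angle between $\dot\alpha_1(t)$ and the meridian tangent vector $(H_1)_u(u(t),v(t))$ equals $\phi_0$. *)

(* Defs.v *)
From HB Require Import structures.
From mathcomp Require Import all_boot all_order all_algebra.
From mathcomp Require Import all_classical all_reals all_analysis.

Set Implicit Arguments.
Unset Strict Implicit.
Unset Printing Implicit Defensive.

Import Order.TTheory GRing.Theory Num.Theory.
Import numFieldNormedType.Exports.

Local Open Scope classical_set_scope.
Local Open Scope ring_scope.

Section hyperbolic.
Context {R : realType}.

Definition sinh (x : R) : R := (expR x - expR (- x)) / 2.
Definition cosh (x : R) : R := (expR x + expR (- x)) / 2.

End hyperbolic.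

Section minkowski.
Context {R : realType} {n : nat}.
Implicit Types x y w : 'rV[R]_n.+1.

Definition mdot x y : R :=
  \sum_(i < n.+1 | i != ord_max) x 0 i * y 0 i - x 0 ord_max * y 0 ord_max.

Definition mnorm w : R := Num.sqrt `|mdot w w|.

Definition spacelike w : Prop := 0 < mdot w w \/ w = 0.
Definition timelike w : Prop := mdot w w < 0.

(* A relation rather than a function of [x] and [y]: by injectivity of sinh on
   R and of cosh on [0, +oo[, at most one [theta] is related to [x] and [y].
   In the mixed case the spacelike vector comes first. *)
Definition lorentz_angle x y (theta : R) : Prop :=
  0 <= theta /\
  ([/\ spacelike x, x != 0, timelike y &
      mdot x y = mnorm x * mnorm y * sinh theta \/
      mdot x y = - (mnorm x * mnorm y * sinh theta)] \/
   [/\ timelike x, timelike y &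
      mdot x y = mnorm x * mnorm y * cosh theta \/
      mdot x y = - (mnorm x * mnorm y * cosh theta)]).

End minkowski.

Section curves.
Context {R : realType}.

Definition open_interval (I : set R) : Prop := open I /\ is_interval I.

(* Functions are total on R; since the domain [I] is open, their iterated
   derivatives at points of [I] depend only on their values on [I]. *)
Definition smooth_on (V : normedModType R) (I : set R) (f : R -> V) : Prop :=
  forall (k : nat) (t : R), I t -> derivable (derive1n k f) t 1.

Definition spacelike_curve n (I : set R) (gamma : R -> 'rV[R]_n.+1) : Prop :=
  forall t, I t -> spacelike (derive1 gamma t).

Definition timelike_curve n (I : set R) (gamma : R -> 'rV[R]_n.+1) : Prop :=
  forall t, I t -> timelike (derive1 gamma t).

End curves.

(* The ambient dimension is [m.+3], i.e. at least 3; the coordinates x_1, x_2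
   and x_n have indices [0], [1] and [ord_max]. *)
Section helicoidal.
Context {R : realType} {m : nat}.
Implicit Types (beta : R -> 'rV[R]_m.+3) (c u v : R) (I J : set R).

Definition H1 beta c u v : 'rV[R]_m.+3 :=
  \row_i if i == 0 then beta u 0 0 * cos v
         else if i == 1 then beta u 0 0 * sin v
         else if i == ord_max then beta u 0 ord_max + c * v
         else beta u 0 i.

Definition H1_u beta c u v : 'rV[R]_m.+3 := derive1 (fun s => H1 beta c s v) u.
Definition H1_v beta c u v : 'rV[R]_m.+3 := derive1 (fun s => H1 beta c u s) v.

Definition coefE beta c u v : R := mdot (H1_u beta c u v) (H1_u beta c u v).
Definition coefF beta c u v : R := mdot (H1_u beta c u v) (H1_v beta c u v).
Definition coefG beta c u v : R := mdot (H1_v beta c u v) (H1_v beta c u v).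

(* Regularity of [beta] follows from [unit_speed]. *)
Record profile_curve I beta (eps : R) : Prop := ProfileCurve {
  profile_dom : open_interval I;
  profile_smooth : smooth_on I beta;
  profile_x2 : forall u, I u -> beta u 0 1 = 0;
  eps_sign : eps = 1 \/ eps = -1;
  unit_speed : forall u, I u -> mdot (derive1 beta u) (derive1 beta u) = eps
}.

Definition timelike_surface I beta c : Prop :=
  forall u v, I u ->
    coefE beta c u v * coefG beta c u v - coefF beta c u v ^+ 2 < 0.

Definition meridian beta c (v0 : R) : R -> 'rV[R]_m.+3 :=
  fun u => H1 beta c u v0.

Definition spacelike_meridians I beta c : Prop :=
  forall v0, spacelike_curve I (meridian beta c v0).

Definition timelike_meridians I beta c : Prop :=
  forall v0, timelike_curve I (meridian beta c v0).

Definition surface_curve beta c (u v : R -> R) : R -> 'rV[R]_m.+3 :=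
  fun t => H1 beta c (u t) (v t).

Definition timelike_loxodrome J beta c (u v : R -> R) (phi0 : R) : Prop :=
  timelike_curve J (surface_curve beta c u v) /\
  forall t, J t ->
    lorentz_angle (H1_u beta c (u t) (v t))
      (derive1 (surface_curve beta c u v) t) phi0.

End helicoidal.

(* Main.v *)
(* Along the curve write the velocity as [du H_u + dv H_v], let [q] be its
   Lorentzian square and [p] its product with [H_u]. As [<H_u, H_u>] is [eps],
   the angle condition on a timelike velocity reads [p^2 + k q = 0], where [k]
   is [sinh^2 phi0] or [cosh^2 phi0]; with E = eps, F = - c x_n' and
   G = x_1^2 - c^2 this is the differential equation. Conversely the equation
   forces [q < 0], because the surface is timelike and [du] does not vanish. *)
Require Import Defs.
From mathcomp Require Import all_boot all_order all_algebra.
From mathcomp Require Import all_classical all_reals all_analysis.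
From mathcomp Require Import ring lra.
Import Order.TTheory GRing.Theory Num.Theory.
Import numFieldNormedType.Exports.
Local Open Scope classical_set_scope.
Local Open Scope ring_scope.


Section lorentzian_angle.
Context {R : realType} {n : nat}.
Implicit Types (x y : 'rV[R]_n.+1) (theta : R).

Lemma cosh2E theta : cosh theta ^+ 2 = 1 + sinh theta ^+ 2.
Proof.
have := expRxMexpNx_1 theta.
rewrite /cosh /sinh; set a := expR theta; set b := expR (- theta) => ab.
apply/eqP; rewrite -subr_eq; apply/eqP; by rewrite -[RHS]ab; field.
Qed.

Lemma mdot0l y : mdot 0 y = 0.
Proof.
by rewrite /mdot big1 ?mxE ?mul0r ?subr0// => i _; rewrite mxE mul0r.
Qed.

Lemma sqr_mnorm x : mnorm x ^+ 2 = `|mdot x x|.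
Proof. by rewrite /mnorm sqr_sqrtr. Qed.

(** Squaring absorbs the choice of sign. Since [y] is timelike, [mnorm y ^+ 2] is [- mdot y y],
    which turns the difference of squares into a sum. *)
Lemma mnorm_mul_signP x y (a s : R) : `|mdot x x| = 1 -> timelike y ->
  a = mnorm x * mnorm y * s \/ a = - (mnorm x * mnorm y * s) <->
  a ^+ 2 + s ^+ 2 * mdot y y = 0.
Proof.
move=> xx yy.
have E : (mnorm x * mnorm y * s) ^+ 2 = - (s ^+ 2 * mdot y y).
  by rewrite !exprMn !sqr_mnorm xx (ltr0_norm yy); ring.
split=> [h|/eqP].
  by rewrite -[s ^+ 2 * _]opprK -E; case: h => ->; rewrite ?sqrrN subrr.
by rewrite addr_eq0 -E eqf_sqr => /orP[]/eqP ->; [left|right].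
Qed.

(** The causal character of [x] rules out the [cosh] alternative in [lorentz_angle]; the [sinh] one
    is then squared. *)
Lemma lorentz_angle_spacelike x y theta : mdot x x = 1 -> 0 <= theta ->
  lorentz_angle x y theta <->
  timelike y /\ mdot x y ^+ 2 + sinh theta ^+ 2 * mdot y y = 0.
Proof.
move=> xx th0; have nx : `|mdot x x| = 1 by rewrite xx normr1.
split=> [[_ [[_ _ ty h]|[tx _ _]]]|[ty h]].
- by split => //; apply/(mnorm_mul_signP _ _ _ _ nx ty).
- by move: tx; rewrite /timelike xx ltr10.
- split=> //; left; split => //; first by left; rewrite xx.
    by apply/eqP => x0; move: xx; rewrite x0 mdot0l => /esym/eqP; rewrite oner_eq0.
  exact/(mnorm_mul_signP _ _ _ _ nx ty).
Qed.

Lemma lorentz_angle_timelike x y theta : mdot x x = -1 -> 0 <= theta ->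
  lorentz_angle x y theta <->
  timelike y /\ mdot x y ^+ 2 + cosh theta ^+ 2 * mdot y y = 0.
Proof.
move=> xx th0; have nx : `|mdot x x| = 1 by rewrite xx normrN1.
split=> [[_ [[sx x0 _ _]|[_ ty h]]]|[ty h]].
- by case: sx => [|x0']; [rewrite xx ltr0N1|rewrite x0' eqxx in x0].
- by split => //; apply/(mnorm_mul_signP _ _ _ _ nx ty).
- split=> //; right; split => //; first by rewrite /timelike xx ltrN10.
  exact/(mnorm_mul_signP _ _ _ _ nx ty).
Qed.

End lorentzian_angle.

Section velocity.
Context {R : realType} {m : nat}.
Implicit Types (beta : R -> 'rV[R]_m.+3) (c a b : R).

(** Closed form of [a H_u + b H_v] at the point with parameters [u], [v]. *)
Definition H1_velocity beta c (u v a b : R) : 'rV[R]_m.+3 :=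
  let x1 := beta u 0 0 in let db := derive1 beta u in
  \row_i if i == 0 then a * db 0 0 * cos v - b * x1 * sin v
         else if i == 1 then a * db 0 0 * sin v + b * x1 * cos v
         else if i == ord_max then a * db 0 ord_max + c * b
         else a * db 0 i.

Lemma derive1_mxE k l (f : R -> 'M[R]_(k, l)) t i j : derivable f t 1 ->
  derive1 f t i j = derive1 (fun s => f s i j) t.
Proof. by move=> df; rewrite derive1E derive_mx// mxE derive1E. Qed.

Lemma is_derive_coord k l (f : R -> 'M[R]_(k, l)) t i j : derivable f t 1 ->
  is_derive t 1 (fun s => f s i j) (derive1 f t i j).
Proof.
move=> df; rewrite derive1_mxE// derive1E; apply: DeriveDef => //.
exact: (derivable_mxP f t 1).1.
Qed.

(** Chain rule, coordinate by coordinate. Arbitrary [u] and [v] let one statement serve the curve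
    and, with one of them constant and the other the identity, both partial derivatives. *)
Lemma derive1_H1_comp beta c (u v : R -> R) t a b :
  derivable beta (u t) 1 -> is_derive t 1 u a -> is_derive t 1 v b ->
  derive1 (fun s => H1 beta c (u s) (v s)) t = H1_velocity beta c (u t) (v t) a b.
Proof.
move=> dbeta du dv.
have dx i : is_derive t 1 (fun s => beta (u s) 0 i) (derive1 beta (u t) 0 i * a).
  apply: (@is_derive1_comp _ (fun s => beta s 0 i) u) => //.
  exact: is_derive_coord.
have dcos : is_derive t 1 (cos \o v) (- sin (v t) * b).
  exact: is_derive1_comp.
have dsin : is_derive t 1 (sin \o v) (cos (v t) * b).
  exact: is_derive1_comp.
have H i j : is_derive t 1 (fun s => H1 beta c (u s) (v s) i j)
                  (H1_velocity beta c (u t) (v t) a b i j).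
  rewrite ord1 !mxE.
  under eq_fun do rewrite mxE.
  case: ifP => _.
    apply: (is_derive_eq (is_deriveM (dx 0) dcos)).
    by rewrite /GRing.scale/=; ring.
  case: ifP => _.
    apply: (is_derive_eq (is_deriveM (dx 0) dsin)).
    by rewrite /GRing.scale/=; ring.
  case: ifP => _.
    apply: (is_derive_eq (is_deriveD (dx ord_max) (is_deriveZ c dv))).
    by rewrite /GRing.scale/=; ring.
  by rewrite mulrC.
have dH : derivable (fun s => H1 beta c (u s) (v s)) t 1.
  by apply/derivable_mxP => i j; have [] := H i j.
by apply/matrixP => i j; rewrite derive1_mxE// derive1E; have [_ ->] := H i j.
Qed.

(** Isolates the coordinates that [H1_velocity] treats specially; on the remaining ones it only
    rescales the derivative of [beta]. *)
Lemma mdot_split (x y : 'rV[R]_m.+3) : mdot x y =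
  x 0 0 * y 0 0 + x 0 1 * y 0 1
  + \sum_(i < m.+3 | [&& i != ord_max, i != 0 & i != 1]) x 0 i * y 0 i
  - x 0 ord_max * y 0 ord_max.
Proof.
rewrite /mdot (bigD1 0)//= (bigD1 1)//= addrA.
by congr (_ + _ - _); apply: eq_bigl => i; rewrite andbA.
Qed.

(** The first fundamental form in polarized form. The angle [v] disappears through
    [cos v ^+ 2 + sin v ^+ 2 = 1], and the vanishing of the second coordinate of the derivative of
    [beta] makes its first coordinate the only one that is rotated. *)
Lemma mdot_H1_velocity beta c (u v a b a' b' : R) :
  derive1 beta u 0 1 = 0 ->
  mdot (H1_velocity beta c u v a b) (H1_velocity beta c u v a' b') =
  a * a' * mdot (derive1 beta u) (derive1 beta u)
  - c * derive1 beta u 0 ord_max * (a * b' + a' * b)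
  + (beta u 0 0 ^+ 2 - c ^+ 2) * (b * b').
Proof.
move=> db1; rewrite !mdot_split !mxE/= db1.
set S := \sum_(i < _ | _) _; set T := \sum_(i < _ | _) _.
have -> : S = a * a' * T.
  rewrite /S /T mulr_sumr; apply: eq_bigr => i /and3P[/negbTE im /negbTE i0 /negbTE i1].
  by rewrite !mxE i0 i1 im; ring.
set x1 := beta u 0 0.
have c2 : cos v ^+ 2 = 1 - sin v ^+ 2 by rewrite -(cos2Dsin2 v) addrK.
rewrite eqxx; ring: c2.
Qed.

(** As [I] is open, the second coordinate agrees with the zero function near [u]. *)
Lemma profile_derive1_x2 I beta eps u : profile_curve I beta eps -> I u ->
  derive1 beta u 0 1 = 0.
Proof.
move=> [[oI _] sI x2 _ _] Iu.
rewrite derive1_mxE; last exact: (sI 0%N).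
rewrite derive1E (@near_eq_derive _ _ _ _ (cst 0)) ?derive_cst//.
have : \forall s \near u, I s by exact: open_nbhs_nbhs.
by apply: filterS => s; exact: x2.
Qed.

End velocity.

(** Reduces the final equivalences to three polynomial identities: [q] and [a] come from
    [angle_eq_timelike], [q'] and [a'] from the inner products, and [b] is the left side of the
    differential equation. *)
Lemma iff_conj_eq (R : realFieldType) (q q' a a' b : R) :
  q = q' -> a = a' -> a' = b -> (a = 0 -> q < 0) ->
  (q' < 0 /\ a' = 0 <-> q' < 0 /\ b = 0) /\ (b = 0 -> q' < 0).
Proof. by move=> <- -> ->. Qed.

(* With [p = eps du + F dv] and [q] the quadratic form below,
   [eps q = p^2 + (eps G - F^2) dv^2]. If [p^2 + k q = 0] and [q >= 0], then
   [p = 0] and this identity gives [dv = 0], hence [du = 0]. *)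
Lemma angle_eq_timelike (R : realFieldType) (eps k F G du dv : R) :
  eps = 1 \/ eps = -1 /\ k != 0 -> 0 <= k -> eps * G - F ^+ 2 < 0 -> du != 0 ->
  (eps * du + F * dv) ^+ 2
    + k * (eps * du ^+ 2 + 2 * F * du * dv + G * dv ^+ 2) = 0 ->
  eps * du ^+ 2 + 2 * F * du * dv + G * dv ^+ 2 < 0.
Proof.
set p := eps * du + F * dv; set q := _ + G * dv ^+ 2.
move=> hk k0 K0 du0 pq; rewrite ltNge; apply/negP => q0.
have eps2 : eps ^+ 2 = 1 by case: hk => [->|[-> _]]; rewrite ?sqrrN expr1n.
have eps0 : eps != 0 by rewrite -sqrf_eq0 eps2 oner_eq0.
have /andP[/eqP p0 /eqP kq0] : (p ^+ 2 == 0) && (k * q == 0).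
  by rewrite -paddr_eq0 ?sqr_ge0 ?mulr_ge0// pq.
have qE : eps * q = (eps * G - F ^+ 2) * dv ^+ 2.
  by rewrite -[RHS]add0r -p0 /p /q; ring: eps2.
have dv0 : dv = 0.
  apply/eqP; rewrite -sqrf_eq0; apply/eqP.
  have dv2 := sqr_ge0 dv.
  (* For [eps = 1], [qE] equates [q >= 0] with a nonpositive number. For [eps = -1] the signs in
     [qE] agree, so [k != 0] is needed to get [q = 0] from [k * q = 0]. *)
  case: hk => [e1|[_ kn0]].
    by move: qE K0; rewrite e1 !mul1r => qE K0; nra.
  move/eqP: kq0; rewrite mulf_eq0 (negbTE kn0) => /eqP q00.
  move: qE; rewrite q00 mulr0 => /esym/eqP.
  by rewrite mulf_eq0 (lt_eqF K0) => /eqP.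
move: p0; rewrite /p dv0 mulr0 addr0 => /eqP.
by rewrite sqrf_eq0 mulf_eq0 (negbTE eps0) (negbTE du0).
Qed.

Theorem lemma3p1 (R : realType) (m : nat) (I : set R)
  (beta : R -> 'rV[R]_m.+3) (eps c : R)
  (hbeta : profile_curve I beta eps) (hc : 0 < c)
  (hM : timelike_surface I beta c)
  (phi0 : R) (hphi0 : 0 <= phi0)
  (J : set R) (hJ : open_interval J) (u v : R -> R)
  (hu : smooth_on J u) (hv : smooth_on J v)
  (huI : forall t, J t -> I (u t))
  (hu' : forall t, J t -> derive1 u t != 0) :
  let x1 : R -> R := fun s => beta s 0 0 in
  let xn : R -> R := fun s => beta s 0 ord_max in
  (spacelike_meridians I beta c ->
    (timelike_loxodrome J beta c u v phi0 <->
     forall t, J t ->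
       (sinh phi0 ^+ 2 * (x1 (u t) ^+ 2 - c ^+ 2)
          + c ^+ 2 * derive1 xn (u t) ^+ 2) * derive1 v t ^+ 2
       - 2 * c * cosh phi0 ^+ 2 * derive1 xn (u t) * derive1 u t * derive1 v t
       + cosh phi0 ^+ 2 * derive1 u t ^+ 2 = 0)) /\
  (timelike_meridians I beta c ->
    (timelike_loxodrome J beta c u v phi0 <->
     forall t, J t ->
       (cosh phi0 ^+ 2 * (x1 (u t) ^+ 2 - c ^+ 2)
          + c ^+ 2 * derive1 xn (u t) ^+ 2) * derive1 v t ^+ 2
       - 2 * c * sinh phi0 ^+ 2 * derive1 xn (u t) * derive1 u t * derive1 v t
       - sinh phi0 ^+ 2 * derive1 u t ^+ 2 = 0)).
Proof.
move=> x1 xn.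
have [_ sI _ eps1 unitb] := hbeta.
have dbeta s : I s -> derivable beta s 1 by exact: (sI 0%N).
have hxn s : I s -> derive1 xn s = derive1 beta s 0 ord_max.
  by move=> Is; rewrite [RHS]derive1_mxE//; exact: dbeta.
have H1uE s w : I s -> H1_u beta c s w = H1_velocity beta c s w 1 0.
  by move=> Is; apply: (derive1_H1_comp beta c id (cst w)) => //; exact: dbeta.
have H1vE s w : I s -> H1_v beta c s w = H1_velocity beta c s w 0 1.
  by move=> Is; apply: (derive1_H1_comp beta c (cst s) id) => //; exact: dbeta.
have is_derive_smooth (f : R -> R) t : smooth_on J f -> J t ->
    is_derive t 1 f (derive1 f t).
  by move=> sf Jt; rewrite derive1E; apply: DeriveDef => //; exact: (sf 0%N).
have curveE t : J t -> derive1 (surface_curve beta c u v) t =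
    H1_velocity beta c (u t) (v t) (derive1 u t) (derive1 v t).
  move=> Jt; apply: derive1_H1_comp; first exact/dbeta/huI.
  - exact: is_derive_smooth.
  - exact: is_derive_smooth.
have dotE s w a b a' b' : I s ->
    mdot (H1_velocity beta c s w a b) (H1_velocity beta c s w a' b') =
    a * a' * eps - c * derive1 xn s * (a * b' + a' * b)
    + (x1 s ^+ 2 - c ^+ 2) * (b * b').
  move=> Is; rewrite mdot_H1_velocity ?unitb ?hxn//.
  exact: profile_derive1_x2 hbeta Is.
have H1u_eps s w : I s -> mdot (H1_u beta c s w) (H1_u beta c s w) = eps.
  by move=> Is; rewrite H1uE// dotE//; ring.
(* This is [E G - F^2 < 0] with [F = - c x_n']. The coefficients do not depend on [v], so the value
   at [v = 0] suffices. *)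
have tl s : I s -> eps * (x1 s ^+ 2 - c ^+ 2) - (- (c * derive1 xn s)) ^+ 2 < 0.
  move=> Is; have := hM s 0 Is.
  rewrite /Defs.coefE /coefF /coefG H1uE// H1vE// !dotE//.
  by congr (_ < _); ring.
(* Makes the claim pointwise in [t]. The timelike requirement on the curve is recovered from the
   equation [P t] itself. *)
have loxodromeP (P : R -> Prop) :
    (forall t, J t ->
      (lorentz_angle (H1_u beta c (u t) (v t))
        (derive1 (surface_curve beta c u v) t) phi0 <->
      timelike (derive1 (surface_curve beta c u v) t) /\ P t) /\
      (P t -> timelike (derive1 (surface_curve beta c u v) t))) ->
    timelike_loxodrome J beta c u v phi0 <-> forall t, J t -> P t.
  move=> angleP; split=> [[_ L] t Jt|L].
    by have [/iffLR/(_ (L t Jt))[]] := angleP t Jt.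
  split=> t Jt; have [aP tP] := angleP t Jt; first exact: tP (L t Jt).
  by apply/aP; split; [exact: tP (L t Jt)|exact: L].
split=> mer; apply: loxodromeP => t Jt; have It := huI t Jt.
(* The meridians determine [eps] once [I] has a point, here [u t]. The zero vector also counts as
   spacelike, but its square would be [-1]. *)
- have e1 : eps = 1.
    case: eps1 => // em; have := mer (v t) (u t) It.
    rewrite /spacelike -/(H1_u _ _ _ _) H1u_eps// em ltr0N1 => -[//|h].
    have := H1u_eps (u t) (v t) It.
    by rewrite h mdot0l em => /eqP; rewrite eq_sym oppr_eq0 oner_eq0.
  have nHu : mdot (H1_u beta c (u t) (v t)) (H1_u beta c (u t) (v t)) = 1.
    by rewrite H1u_eps.
  rewrite (lorentz_angle_spacelike _ _ _ nHu hphi0) /timelike.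
  rewrite curveE// H1uE// !dotE//.
  have := angle_eq_timelike _ eps (sinh phi0 ^+ 2) _ _ _ (derive1 v t)
    (or_introl e1) (sqr_ge0 _) (tl _ It) (hu' t Jt).
  (* With [cosh] eliminated, the coefficient [1 + sinh phi0 ^+ 2] of [du^2] arises from [p^2 + k q]
     with [k = sinh phi0 ^+ 2]. *)
  rewrite cosh2E e1; apply: iff_conj_eq; ring.
- have em : eps = -1.
    case: eps1 => // e1; have := mer (v t) (u t) It.
    by rewrite /timelike -/(H1_u _ _ _ _) H1u_eps// e1 ltr10.
  have nHu : mdot (H1_u beta c (u t) (v t)) (H1_u beta c (u t) (v t)) = -1.
    by rewrite H1u_eps.
  rewrite (lorentz_angle_timelike _ _ _ nHu hphi0) /timelike.
  rewrite curveE// H1uE// !dotE//.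
  (* This is the condition [k != 0] that [angle_eq_timelike] imposes when [eps = -1]. *)
  have c0 : cosh phi0 ^+ 2 != 0.
    by rewrite cosh2E gt_eqF// ltr_wpDr ?sqr_ge0.
  have := angle_eq_timelike _ eps (cosh phi0 ^+ 2) _ _ _ (derive1 v t)
    (or_intror (conj em c0)) (sqr_ge0 _) (tl _ It) (hu' t Jt).
  rewrite cosh2E em; apply: iff_conj_eq; ring.
Qed.
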